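(* Let $d,K\ge1$, $\Theta=\{1,\dots,K\}$, and for each $\theta\in\Theta$ let $\mathcal D_\theta$ be a probability distribution of $(r,\mathbf a)\in\mathbb R_+\times\mathbb R_+^d$ satisfying the boundedness and continuous-valuation assumptions of the context. Let $\mathbf b\in\mathbb R_+^d$ with $b_{\min}:=\min_i b_i>0$, $P_{\max}=2R_{\max}/b_{\min}$, $\mathcal P=[0,P_{\max}]^d$. Define $$f(\mathbf p):=\langle\mathbf p,\mathbf b\rangle+\max_{\theta\in\Theta}g_\theta(\mathbf p),\qquad \mathcal P^\star:=\arg\min_{\mathbf p\in\mathcal P}f(\mathbf p).$$ Then the set of saddle points of $L$ on $\Delta_K\times\mathcal P$ is exactly $$\mathcal S=\Big\{(\mathbf w,\mathbf p)\in\Delta_K\times\mathcal P:\ \mathbf p\in\mathcal P^\star,\ \mathrm{supp}(\mathbf w)\subseteq A(\mathbf p),\ H(\mathbf w,\mathbf p)\le\mathbf b,\ \langle\mathbf p,\mathbf b-H(\mathbf w,\mathbf p)\rangle=0\Big\}.$$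
   Context: $\mathbb E_\theta$ denotes expectation under $(r,\mathbf a)\sim\mathcal D_\theta$; $(x)_+=\max\{x,0\}$; $\Delta_K$ is the probability simplex in $\mathbb R^K$; vector inequalities are componentwise. Assumptions. Boundedness: there are $R_{\max},A_{\max}>0$ with $0\le r\le R_{\max}$ and $\|\mathbf a\|_\infty\le A_{\max}$ a.s. under every $\mathcal D_\theta$. Continuous valuation: for every $\theta$, if $(r,\mathbf a)\sim\mathcal D_\theta$, the conditional distribution of $r$ given $\mathbf a=\boldsymbol\alpha$ is continuous (has no atoms) for every $\boldsymbol\alpha$ in the support of $\mathbf a$; in particular $\mathbb P_\theta(r=\langle\mathbf p,\mathbf a\rangle)=0$ for every $\mathbf p\in\mathbb R^d$. (In the online problem, the distributions are time-invariant, the pair observed when configuration $\theta$ is selected is an independent draw from $\mathcal D_\theta$, and the total budget over $T$ periods is $\mathbf B=T\mathbf b$.) Definitions. $g_\theta(\mathbf p):=\mathbb E_\theta[(r-\langle\mathbf p,\mathbf a\rangle)_+]$; $h_\theta(\mathbf p):=\mathbb E_\theta[\mathbf a\,\mathbf 1\{r>\langle\mathbf p,\mathbf a\rangle\}]$; $L(\mathbf w,\mathbf p):=\langle\mathbf p,\mathbf b\rangle+\sum_\theta w_\theta g_\theta(\mathbf p)$; $H(\mathbf w,\mathbf p):=\sum_\theta w_\theta h_\theta(\mathbf p)$; $A(\mathbf p):=\arg\max_{\theta\in\Theta}g_\theta(\mathbf p)$; $\mathrm{supp}(\mathbf w)=\{\theta:w_\theta>0\}$. $(\mathbf w^\star,\mathbf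 p^\star)\in\Delta_K\times\mathcal P$ is a saddle point of $L$ if $L(\mathbf w,\mathbf p^\star)\le L(\mathbf w^\star,\mathbf p^\star)\le L(\mathbf w^\star,\mathbf p)$ for all $\mathbf w\in\Delta_K$, $\mathbf p\in\mathcal P$. *)

(* Defs.v *)
From HB Require Import structures.
From mathcomp Require Import all_boot all_order all_algebra.
From mathcomp Require Import all_classical all_reals all_analysis.

Set Implicit Arguments.
Unset Strict Implicit.
Unset Printing Implicit Defensive.

Import Order.TTheory GRing.Theory Num.Theory.
Import numFieldNormedType.Exports.

Local Open Scope classical_set_scope.
Local Open Scope ring_scope.

(* The library puts the product sigma-algebra on tuples and the sup norm on row
   vectors.  Random vectors are therefore tuples, read as row vectors through
   [vec_of]; prices, budgets and weights are row vectors.  Dimensions have the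
   form n.+1, so that they are at least 1. *)
Definition vec_of (R : realType) (d : nat) (a : d.-tuple R) : 'rV[R]_d :=
  \row_i tnth a i.

Definition dot (R : realType) (d : nat) (u v : 'rV[R]_d) : R :=
  \sum_(i < d) u 0 i * v 0 i.

Definition le_vec (R : realType) (d : nat) (u v : 'rV[R]_d) : Prop :=
  forall i, u 0 i <= v 0 i.

Definition argmax (R : realType) (T : Type) (F : T -> R) (X : set T) : set T :=
  [set x | X x /\ forall y, X y -> F y <= F x].

Definition argmin (R : realType) (T : Type) (F : T -> R) (X : set T) : set T :=
  [set x | X x /\ forall y, X y -> F x <= F y].

Definition simplex (R : realType) (K : nat) : set 'rV[R]_K :=
  [set w | (forall k, 0 <= w 0 k) /\ \sum_(k < K) w 0 k = 1].

Definition supp_w (R : realType) (K : nat) (w : 'rV[R]_K) : set 'I_K :=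
  [set k | 0 < w 0 k].

(* Joint law of (r, a); x.1 is the valuation r and x.2 the request vector a. *)
Notation law R d := (probability (prod R (d.-tuple R)) R).

Definition law_on_orthant (R : realType) (d : nat) (D : law R d) : Prop :=
  {ae D, forall x, 0 <= x.1 /\ le_vec 0 (vec_of x.2)}.

Definition bounded_law (R : realType) (d : nat) (Rmax Amax : R)
    (D : law R d) : Prop :=
  {ae D, forall x, 0 <= x.1 <= Rmax /\ `|vec_of x.2| <= Amax}.

Definition marginal_a (R : realType) (d : nat) (D : law R d) :
    set (d.-tuple R) -> \bar R :=
  pushforward D snd.

(* Topological support: every neighbourhood of alpha has positive mass. *)
Definition msupport (R : realType) (d : nat)
    (mu : set (d.-tuple R) -> \bar R) : set (d.-tuple R) :=
  [set alpha | forall e : R, 0 < e ->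
    (0 < mu [set beta | ball (vec_of alpha) e (vec_of beta)])%E].

(* Disintegration: [k] is a version of the conditional law of r given a. *)
Definition is_cond_dist (R : realType) (d : nat) (D : law R d)
    (k : R.-pker (d.-tuple R) ~> R) : Prop :=
  forall (U : set R) (V : set (d.-tuple R)), measurable U -> measurable V ->
    (D (U `*` V) = \int[marginal_a D]_(alpha in V) k alpha U)%E.

(* Conditional distributions are determined only up to a null set of values of
   a; the requirement is that some version has no atoms on the support. *)
Definition continuous_valuation (R : realType) (d : nat) (D : law R d) :
    Prop :=
  exists k : R.-pker (d.-tuple R) ~> R, is_cond_dist D k /\
    forall alpha, msupport (marginal_a D) alpha ->
      forall t : R, k alpha [set t] = 0%E.

Definition gfun (R : realType) (d : nat) (D : law R d) (p : 'rV[R]_d) : R :=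
  fine ('E_D[fun x => Num.max (x.1 - dot p (vec_of x.2)) 0]).

Definition hfun (R : realType) (d : nat) (D : law R d) (p : 'rV[R]_d) :
    'rV[R]_d :=
  \row_i fine ('E_D[fun x =>
    tnth x.2 i * \1_[set y : R * d.-tuple R | y.1 > dot p (vec_of y.2)] x]).

Definition lagrangian (R : realType) (d K : nat) (D : 'I_K -> law R d)
    (b : 'rV[R]_d) (w : 'rV[R]_K) (p : 'rV[R]_d) : R :=
  dot p b + \sum_(k < K) w 0 k * gfun (D k) p.

Definition consumption (R : realType) (d K : nat) (D : 'I_K -> law R d)
    (w : 'rV[R]_K) (p : 'rV[R]_d) : 'rV[R]_d :=
  \sum_(k < K) w 0 k *: hfun (D k) p.

Definition best_configs (R : realType) (d K : nat) (D : 'I_K -> law R d)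
    (p : 'rV[R]_d) : set 'I_K :=
  argmax (fun k => gfun (D k) p) setT.

(* The defaults of the iterated min and max below are among the terms, so these
   are the plain min and max. *)
Definition bmin (R : realType) (d : nat) (b : 'rV[R]_d.+1) : R :=
  \big[Num.min/b 0 ord0]_(i < d.+1) b 0 i.

Definition Pmax (R : realType) (d : nat) (Rmax : R) (b : 'rV[R]_d.+1) : R :=
  2 * Rmax / bmin b.

Definition price_box (R : realType) (d : nat) (M : R) : set 'rV[R]_d :=
  [set p | forall i, 0 <= p 0 i <= M].

Definition dual_obj (R : realType) (d K : nat) (D : 'I_K.+1 -> law R d)
    (b p : 'rV[R]_d) : R :=
  dot p b + \big[Num.max/gfun (D ord0) p]_(k < K.+1) gfun (D k) p.

Definition saddle_points (R : realType) (T U : Type) (F : T -> U -> R)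
    (X : set T) (Y : set U) : set (T * U) :=
  [set z | [/\ X z.1, Y z.2,
    forall x, X x -> F x z.2 <= F z.1 z.2 &
    forall y, Y y -> F z.1 z.2 <= F z.1 y]].

Definition kkt_set (R : realType) (d K : nat) (D : 'I_K.+1 -> law R d)
    (b : 'rV[R]_d) (P : set 'rV[R]_d) : set ('rV[R]_K.+1 * 'rV[R]_d) :=
  [set z | [/\ simplex z.1 /\ P z.2,
    argmin (dual_obj D b) P z.2,
    supp_w z.1 `<=` best_configs D z.2,
    le_vec (consumption D z.1 z.2) b &
    dot z.2 (b - consumption D z.1 z.2) = 0]].

(* Main.v *)
Require Import Defs.
From HB Require Import structures.
From mathcomp Require Import all_boot all_order all_algebra.
From mathcomp Require Import all_classical all_reals all_analysis.
From mathcomp Require Import measurable_realfun.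
From mathcomp Require Import lra.

Import Order.TTheory GRing.Theory Num.Theory.
Import numFieldNormedType.Exports.

Local Open Scope classical_set_scope.
Local Open Scope ring_scope.

(** Pointwise convexity of [p |-> (r - <p, a>)_+] makes [b - H (w, p)] a
    subgradient of [L (w, .)] at [p], so complementary slackness suffices for a
    saddle point.  Conversely, the subgradient inequality at [p + (q - p) / n]
    and the continuity of [h] give [0 <= <q - p, b - H (w, p)>] for every price
    [q] when [p] minimizes [L (w, .)]; [h] is continuous because ties
    [r = <p, a>] have probability zero.  Testing [q] that differ from [p] in one
    coordinate gives complementary slackness, since the upper bound [Pmax] is
    never attained by a minimizer. *)

(** * Disintegration and topological support *)

(** The right-hand side is a measure in [A] that agrees with [P] on rectangles, a generating class
    closed under intersection, so the two measures coincide. *)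
Lemma prob_prod_disintegration {d1 d2} {T1 : measurableType d1}
    {T2 : measurableType d2} {R : realType}
    (P : probability (T1 * T2)%type R) (mu : {measure set T2 -> \bar R})
    (k : R.-fker T2 ~> T1) :
  (forall U V, measurable U -> measurable V ->
    P (U `*` V) = \int[mu]_(y in V) k y U)%E ->
  forall A, measurable A -> let phi y := k y (ysection A y) in
    measurable_fun setT phi /\
    P A = (\int[mu]_y k y (ysection A y))%E.
Proof.
move=> PE; pose phi A y := k y (ysection A y).
have mk A : measurable A -> measurable_fun setT (phi A).
  (* Swapping coordinates turns the sections of [A] into x-sections, whose kernel measure is known
     to be measurable. *)
  move=> mA; set B := (fun z : T2 * T1 => (z.2, z.1)) @^-1` A.
  have mB : measurable B.
    rewrite -[B]setTI; apply: measurable_fun_pair => //.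
  have -> : phi A = (fun y => k y (xsection B y)).
    by apply/funext => y; congr (k y _); apply/seteqP; split => x /=;
      rewrite /xsection /ysection/= !inE.
  by apply: measurable_fun_xsection_finite_kernel; rewrite inE.
move=> A mA; split; first exact: mk.
pose Q := fun B : set (T1 * T2) => (\int[mu]_y k y (ysection B y))%E.
have Q0 : Q set0 = 0%E.
  by rewrite /Q; apply: integral0_eq => y _; rewrite ysection0.
have Qge0 B : (0 <= Q B)%E by apply: integral_ge0.
have Qsa : semi_sigma_additive Q.
  move=> F mF tF mUF.
  have -> : Q (\bigcup_n F n) = (\sum_(0 <= n <oo) Q (F n))%E.
    rewrite /Q -integral_nneseries//; last by move=> n; exact: mk.
    apply: eq_integral => y _; rewrite ysection_bigcup.
    rewrite measure_bigcup//; last 2 first.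
    - by move=> n _; exact: measurable_ysection.
    - exact: trivIset_ysection.
    by apply: eq_eseriesl => n; rewrite in_setT.
  by apply: is_cvg_ereal_nneg_natsum_cond => n _ _; exact: Qge0.
pose M : {measure set (T1 * T2)%type -> \bar R} :=
  HB.pack Q (isMeasure.Build _ _ _ Q Q0 Qge0 Qsa).
have -> : (\int[mu]_y k y (ysection A y))%E = M A by [].
(* The constant sequence [setT] exhausts the space by sets of finite mass because [P] is finite. *)
apply: (measure_unique [set U `*` V | U in measurable & V in measurable]
  (fun=> setT)) => //.
- exact: measurable_prod_measurableType.
- move=> _ _ [U mU [V mV <-]] [U' mU' [V' mV' <-]].
  exists (U `&` U'); first exact: measurableI.
  by exists (V `&` V'); [exact: measurableI|rewrite setXI].
- by move=> _; exists setT => //; exists setT => //; rewrite setXTT.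
- by rewrite bigcup_const.
- move=> _ [U mU [V mV <-]]; rewrite [LHS]PE//.
  rewrite /M/= /Q integral_mkcond; apply: eq_integral => y _.
  rewrite patchE; case: ifPn => yV; first by rewrite in_ysectionX.
  by rewrite notin_ysectionX// measure0.
- by move=> _; rewrite (le_lt_trans (probability_le1 P measurableT)) ?ltry.
Qed.

Lemma measurable_ball_vec_of (R : realType) (d : nat) (c : 'rV[R]_d) (e : R) :
  measurable [set b : d.-tuple R | ball c e (vec_of b)].
Proof.
(* The ball of row vectors includes the condition [0 < e], hence is empty for other radii. *)
have [e0|e0] := ltP 0 e; last first.
  rewrite (_ : [set _ | _] = set0)//; apply/seteqP; split => // b [].
  by rewrite ltNge e0.
have -> : [set b : d.-tuple R | ball c e (vec_of b)] =
    \bigcap_(i in [set: 'I_d]) ((fun b => tnth b i) @^-1` ball (c 0 i) e).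
  apply/seteqP; split => [b [_ cb] i _|b cb]; first by have := cb 0 i; rewrite mxE.
  by split=> // i j; rewrite ord1 mxE; exact: cb.
apply: fin_bigcap_measurable => // i _; rewrite -[X in measurable X]setTI.
by apply: measurable_tnth => //; exact: measurable_ball.
Qed.

(* Outside the support every point lies in a null ball with rational centre and
   radius, and there are countably many of those. *)
Lemma ae_msupport (R : realType) (d : nat)
    (mu : {measure set (d.-tuple R) -> \bar R}) :
  {ae mu, forall a, msupport mu a}.
Proof.
pose B (u : {ffun 'I_d -> rat} * rat) : set (d.-tuple R) :=
  [set b | ball (\row_i ratr (u.1 i) : 'rV[R]_d) (ratr u.2) (vec_of b)].
have mB u : measurable (B u) by exact: measurable_ball_vec_of.
(* Indices that code no ball and balls of positive mass contribute [set0], so the union runs over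
   null balls only. *)
pose F n := if unpickle n is Some u then if mu (B u) == 0%E then B u else set0
  else set0.
apply: (@negligibleS _ _ _ _ (\bigcup_n F n)); last first.
  apply: negligible_bigcup => n; rewrite /F; case: unpickle => [u|]; last first.
    exact: negligible_set0.
  case: eqP => [Bu0|_]; last exact: negligible_set0.
  exact/negligibleP.
move=> a /= /existsNP[e /not_implyP[e0 /negP]].
rewrite -leNgt measure_le0 => /eqP mu0.
(* The centre [q] will lie within [s] of [a]; since [2 * s < e], its ball of radius [s] stays in the
   null ball of radius [e] around [a]. *)
have [s] : exists s : rat, ratr s \in `]0, (e / 2)[ by apply: rat_in_itvoo; lra.
rewrite in_itv/= => /andP[s0 se].
have Q (i : 'I_d) : exists q : rat,
    ratr q \in `](tnth a i - ratr s), (tnth a i + ratr s)[.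
  by apply: rat_in_itvoo; lra.
pose q := [ffun i => sval (cid (Q i))].
have qa i : `|ratr (q i) - tnth a i| < ratr s.
  rewrite ffunE; case: cid => r /=; rewrite in_itv/= => /andP[? ?].
  by rewrite ltr_norml; apply/andP; split; lra.
exists (pickle (q, s)) => //; rewrite /F pickleK.
have -> : mu (B (q, s)) == 0%E.
  rewrite -measure_le0 -mu0 le_measure// ?inE; first exact: mB.
    exact: measurable_ball_vec_of.
  move=> b [_ qb]; split => // i j; have := qb i j; have := qa j.
  rewrite !mxE /ball/= !ltr_norml.
  by move=> /andP[? ?] /andP[? ?]; apply/andP; split; lra.
by split => // i j; rewrite !mxE /ball/=; exact: qa.
Qed.

(** * Bilinearity of the dot product *)

Lemma dotC (R : realType) (d : nat) (u v : 'rV[R]_d) : dot u v = dot v u.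
Proof. by apply: eq_bigr => i _; rewrite mulrC. Qed.

Lemma dotDr (R : realType) (d : nat) (u v w : 'rV[R]_d) :
  dot u (v + w) = dot u v + dot u w.
Proof. by rewrite -big_split; apply: eq_bigr => i _; rewrite mxE mulrDr. Qed.

Lemma dotZr (R : realType) (d : nat) (a : R) (u v : 'rV[R]_d) :
  dot u (a *: v) = a * dot u v.
Proof. by rewrite mulr_sumr; apply: eq_bigr => i _; rewrite mxE mulrCA. Qed.

Lemma dotBr (R : realType) (d : nat) (u v w : 'rV[R]_d) :
  dot u (v - w) = dot u v - dot u w.
Proof. by rewrite dotDr -scaleN1r dotZr mulN1r. Qed.

Lemma dotDl (R : realType) (d : nat) (u v w : 'rV[R]_d) :
  dot (u + v) w = dot u w + dot v w.
Proof. by rewrite !(dotC _ _ _ w) dotDr. Qed.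

Lemma dotBl (R : realType) (d : nat) (u v w : 'rV[R]_d) :
  dot (u - v) w = dot u w - dot v w.
Proof. by rewrite !(dotC _ _ _ w) dotBr. Qed.

Lemma dotZl (R : realType) (d : nat) (a : R) (u v : 'rV[R]_d) :
  dot (a *: u) v = a * dot u v.
Proof. by rewrite !(dotC _ _ _ v) dotZr. Qed.

Lemma dot0l (R : realType) (d : nat) (u : 'rV[R]_d) : dot 0 u = 0.
Proof. by rewrite /dot big1// => i _; rewrite mxE mul0r. Qed.

(** * Ties have probability zero *)

Lemma measurable_tnth_snd (R : realType) (d : nat) (i : 'I_d) :
  measurable_fun [set: R * d.-tuple R] (fun x => tnth x.2 i).
Proof. exact: (measurableT_comp (measurable_tnth i) measurable_snd). Qed.

Lemma measurable_cost (R : realType) (d : nat) (p : 'rV[R]_d) :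
  measurable_fun [set: R * d.-tuple R] (fun x => dot p (vec_of x.2)).
Proof.
apply: measurable_sum => i; under eq_fun do rewrite mxE.
by apply: measurable_funM => //; exact: measurable_tnth_snd.
Qed.

(** Given [a], a tie fixes [r] to a single value, an event of conditional mass zero for [a] in the
    support, hence for almost every [a]; disintegration integrates this. *)
Lemma no_ties (R : realType) (d : nat) (D : law R d) (p : 'rV[R]_d) :
  continuous_valuation D -> {ae D, forall x, x.1 <> dot p (vec_of x.2)}.
Proof.
move=> [k [kD k0]].
pose E : set (R * d.-tuple R) := [set x | x.1 = dot p (vec_of x.2)].
have mE : measurable E.
  have -> : E = (fun x => x.1 == dot p (vec_of x.2)) @^-1` [set true].
    by apply/seteqP; split => x /eqP.
  rewrite -[X in measurable X]setTI.
  by apply: measurable_fun_eqr => //; exact: measurable_cost.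
exists E; split => //; last by move=> x /= /contrapT.
(* [mu] is [marginal_a D] with its measure structure. *)
pose mu := measure_function_pushforward__canonical__measure_function_Measure D
  (@measurable_snd _ _ R (d.-tuple R)).
have [mphi ->] := @prob_prod_disintegration _ _ _ _ _ D mu k kD E mE.
rewrite (_ : 0%E = \int[mu]_y (cst 0%E y))%E; last by rewrite integral0.
apply: ge0_ae_eq_integral => //.
apply: filterS (@ae_msupport R d mu) => a aS _.
rewrite -(k0 _ aS (dot p (vec_of a))); congr (k a _).
by apply/seteqP; split => r; rewrite /ysection /E /= inE.
Qed.

(** * Integrability of surplus and demand *)

Lemma integrable_ae_bounded {d} {T : measurableType d} {R : realType}
    (P : probability T R) (f : T -> R) (M : R) :
  measurable_fun setT f -> {ae P, forall x, `|f x| <= M} ->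
  P.-integrable setT (EFin \o f).
Proof.
move=> mf fM; apply/integrableP; split; first exact/measurable_EFinP.
apply: (@le_lt_trans _ _ (\int[P]_x (`|M|)%:E)%E).
  apply: ae_ge0_le_integral => //.
  - by apply: measurableT_comp => //; exact/measurable_EFinP.
  - apply: filterS fM => x fx _; rewrite lee_fin (le_trans fx)//.
    exact: ler_norm.
by rewrite integral_cst//= probability_setT mule1 ltry.
Qed.

Lemma Rintegral_lincomb {d} {T : measurableType d} {R : realType}
    (mu : {measure set T -> \bar R}) (n : nat) (c : 'I_n -> R)
    (f : 'I_n -> T -> R) :
  (forall i, mu.-integrable setT (EFin \o f i)) ->
  mu.-integrable setT (EFin \o (fun x => \sum_i c i * f i x)) /\
  \int[mu]_x (\sum_i c i * f i x) = \sum_i c i * \int[mu]_x f i x.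
Proof.
move=> fint.
have cfint i : mu.-integrable setT (EFin \o (fun x => c i * f i x)).
  exact: (integrableZl measurableT (c i) (fint i)).
have E : EFin \o (fun x => \sum_i c i * f i x) =
    (fun x => \sum_i (c i * f i x)%:E)%E.
  by apply/funext => x; rewrite /= sumEFin.
split; first by rewrite E; apply: integrable_sum => // i _; exact: cfint.
rewrite /Rintegral.
under eq_integral do rewrite -sumEFin.
rewrite integral_sum// -sum_fine; last first.
  by move=> i _; apply: (integrable_fin_num measurableT); exact: cfint.
by apply: eq_bigr => i _; rewrite -RintegralZl.
Qed.

(** [surplus] and [demand] are the integrands of [gfun] and [hfun], named so that pointwise
    inequalities and limits can be integrated. *)
Definition surplus {R : realType} {d : nat} (p : 'rV[R]_d)
  (x : R * d.-tuple R) : R := Num.max (x.1 - dot p (vec_of x.2)) 0.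

Definition demand {R : realType} {d : nat} (p : 'rV[R]_d) (i : 'I_d)
    (x : R * d.-tuple R) : R :=
  tnth x.2 i * \1_[set y : R * d.-tuple R | y.1 > dot p (vec_of y.2)] x.

Lemma gfunE (R : realType) (d : nat) (D : law R d) (p : 'rV[R]_d) :
  gfun D p = \int[D]_x surplus p x.
Proof. by rewrite /gfun unlock. Qed.

Lemma hfunE (R : realType) (d : nat) (D : law R d) (p : 'rV[R]_d) i :
  hfun D p 0 i = \int[D]_x demand p i x.
Proof. by rewrite mxE unlock. Qed.

Lemma indicT (T : Type) (R : pzRingType) (A : set T) (x : T) :
  A x -> \1_A x = 1 :> R.
Proof. by move=> Ax; rewrite indicE mem_set. Qed.

Lemma indicF (T : Type) (R : pzRingType) (A : set T) (x : T) :
  ~ A x -> \1_A x = 0 :> R.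
Proof. by move=> Ax; rewrite indicE memNset. Qed.

(** If [r] exceeds its cost at [p], the left side is [r - <q, a>]; otherwise, ties included, it is
    [0]. Both are at most the positive part at [q]. *)
Lemma surplus_subgradient (R : realType) (d : nat) (p q : 'rV[R]_d)
    (x : R * d.-tuple R) :
  surplus p x + \sum_i (p - q) 0 i * demand p i x <= surplus q x.
Proof.
rewrite /demand /surplus; set A := [set y | _].
have -> : \sum_i (p - q) 0 i * (tnth x.2 i * \1_A x) =
    dot (p - q) (vec_of x.2) * \1_A x.
  by rewrite mulr_suml; apply: eq_bigr => i _; rewrite !mxE mulrA.
rewrite dotBl; have [px|px] := ltP (dot p (vec_of x.2)) x.1.
  rewrite indicT// max_l; last lra.
  by rewrite le_max; apply/orP; left; lra.
rewrite indicF; last by rewrite /A/= ltNge px.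
by rewrite mulr0 addr0 max_r ?le_max ?lexx ?orbT//; lra.
Qed.

Lemma measurable_surplus (R : realType) (d : nat) (p : 'rV[R]_d) :
  measurable_fun setT (surplus p).
Proof.
apply: measurable_maxr => //; apply: measurable_funB => //.
exact: measurable_cost.
Qed.

Lemma measurable_demand (R : realType) (d : nat) (p : 'rV[R]_d) (i : 'I_d) :
  measurable_fun setT (demand p i).
Proof.
apply: measurable_funM; first exact: measurable_tnth_snd.
apply: measurable_indic; rewrite -[X in measurable X]setTI.
have := @measurable_fun_ltr _ _ R setT _ fst (measurable_cost _ _ p)
  (@measurable_fst _ _ R (d.-tuple R)) measurableT [set true].
rewrite (_ : (fun x => _) @^-1` _ =
  [set y : R * d.-tuple R | y.1 > dot p (vec_of y.2)]); first exact.
by apply/seteqP; split => x.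
Qed.

Lemma bounded_lawP (R : realType) (d : nat) (Rmax Amax : R) (D : law R d) :
  bounded_law Rmax Amax D ->
  {ae D, forall x, 0 <= x.1 <= Rmax /\ forall i, `|tnth x.2 i| <= Amax}.
Proof.
apply: filterS => x [xR xA]; split => // i; apply: le_trans xA.
rewrite [leRHS]/Num.Def.normr /= mx_normrE; apply/bigmax_geP; right => /=.
by exists (0, i) => //=; rewrite mxE.
Qed.

Lemma ae_demand_bounded (R : realType) (d : nat) (Rmax Amax : R)
    (D : law R d) : bounded_law Rmax Amax D ->
  {ae D, forall x p i, `|demand p i x| <= Amax}.
Proof.
move/bounded_lawP; apply: filterS => x [_ xA] p i.
rewrite normrM indicE; case: (_ \in _); rewrite ?normr1 ?normr0 ?mulr1 ?mulr0//.
by rewrite (le_trans _ (xA i)).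
Qed.

Lemma integrable_demand (R : realType) (d : nat) (Rmax Amax : R) (D : law R d)
    (p : 'rV[R]_d) (i : 'I_d) : bounded_law Rmax Amax D ->
  D.-integrable setT (EFin \o demand p i).
Proof.
move=> /ae_demand_bounded DA; apply: (@integrable_ae_bounded _ _ _ _ _ Amax).
  exact: measurable_demand.
by apply: filterS DA => x /(_ p i).
Qed.

Lemma integrable_surplus (R : realType) (d : nat) (Rmax Amax : R) (D : law R d)
    (p : 'rV[R]_d) : bounded_law Rmax Amax D ->
  D.-integrable setT (EFin \o surplus p).
Proof.
move=> /bounded_lawP DA.
apply: (@integrable_ae_bounded _ _ _ _ _ (Rmax + \sum_i `|p 0 i| * Amax)).
  exact: measurable_surplus.
apply: filterS DA => x [/andP[x0 xR] xA].
have : `|dot p (vec_of x.2)| <= \sum_i `|p 0 i| * Amax.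
  apply: le_trans (ler_norm_sum _ _ _) _; apply: ler_sum => i _.
  by rewrite normrM mxE ler_wpM2l.
rewrite ler_norml => /andP[? ?].
by rewrite ler_norml /surplus; case: (leP (x.1 - _) 0) => ?; apply/andP; split; lra.
Qed.

(** * Expected surplus and demand as functions of the price *)

(** Integrating the pointwise inequality makes [- hfun D p] a subgradient of [gfun D] at [p]. *)
Lemma gfun_subgradient (R : realType) (d : nat) (Rmax Amax : R) (D : law R d)
    (p q : 'rV[R]_d) : bounded_law Rmax Amax D ->
  gfun D p + dot (p - q) (hfun D p) <= gfun D q.
Proof.
move=> DA; have fint i := @integrable_demand _ _ _ _ _ p i DA.
have sint p' := @integrable_surplus _ _ _ _ _ p' DA.
have [lint lE] := Rintegral_lincomb _ _ (fun i => (p - q) 0 i) _ fint.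
rewrite !gfunE /dot; under eq_bigr do rewrite hfunE.
rewrite -lE -RintegralD//; apply: le_Rintegral => //.
  exact: (integrableD measurableT (sint p) lint).
by move=> x _; exact: surplus_subgradient.
Qed.

Lemma gfun_ge0 (R : realType) (d : nat) (D : law R d) (p : 'rV[R]_d) :
  0 <= gfun D p.
Proof.
by rewrite gfunE; apply: Rintegral_ge0 => x _; rewrite /surplus le_max lexx orbT.
Qed.

Lemma gfun0_le (R : realType) (d : nat) (Rmax Amax : R) (D : law R d) :
  0 <= Rmax -> bounded_law Rmax Amax D -> gfun D 0 <= Rmax.
Proof.
move=> R0 DA; rewrite gfunE -lee_fin fineK; last first.
  exact: (integrable_fin_num measurableT (integrable_surplus _ _ _ _ _ _ DA)).
apply: (@le_trans _ _ (\int[D]_x Rmax%:E)%E); last first.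
  by rewrite integral_cst//= probability_setT mule1.
apply: ae_ge0_le_integral => //.
- by move=> x _; rewrite lee_fin le_max lexx orbT.
- by apply/measurable_EFinP; exact: measurable_surplus.
- apply: filterS DA => x [/andP[x0 xR] _] _.
  by rewrite lee_fin /surplus dot0l subr0 max_l.
Qed.

(** Dominated convergence with the constant bound [Amax]. Prices enter the demand only through dot
    products, so their convergence is stated in that form. *)
Lemma hfun_cvg (R : realType) (d : nat) (Rmax Amax : R) (D : law R d)
    (q : nat -> 'rV[R]_d) (p : 'rV[R]_d) (i : 'I_d) :
  bounded_law Rmax Amax D -> continuous_valuation D ->
  (forall u, dot (q n) u @[n --> \oo] --> dot p u) ->
  hfun D (q n) 0 i @[n --> \oo] --> hfun D p 0 i.
Proof.
move=> DA Dc qp; rewrite hfunE; under eq_fun do rewrite hfunE.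
apply: fine_cvg; rewrite fineK; last first.
  exact: (integrable_fin_num measurableT (integrable_demand _ _ _ _ _ _ _ DA)).
have [//|||||_ _] := @dominated_convergence _ _ _ D setT measurableT
  (fun n => EFin \o demand (q n) i) (EFin \o demand p i) (cst Amax%:E); last exact.
- by move=> n; apply/measurable_EFinP; exact: measurable_demand.
- by apply/measurable_EFinP; exact: measurable_demand.
- apply: filterS (no_ties _ _ _ p Dc) => x /eqP xp _.
  (* Away from a tie the strict comparison persists for large [n], so the demand is eventually
     constant. *)
  apply: cvg_near_cst.
  have := qp (vec_of x.2); rewrite /= => {}qp.
  case: (ltgtP x.1 (dot p (vec_of x.2))) xp => // xp _; near=> n.
    have xq : x.1 < dot (q n) (vec_of x.2) by near: n; exact: cvgr_gt qp _ xp.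
    by rewrite /demand /= !indicF//=; apply/negP; rewrite -leNgt ltW.
  have xq : dot (q n) (vec_of x.2) < x.1 by near: n; exact: cvgr_lt qp _ xp.
  by rewrite /demand /= !indicT.
- exact: finite_measure_integrable_cst.
- apply: filterS (ae_demand_bounded _ _ _ _ _ DA) => x xA n _.
  by rewrite lee_fin.
Unshelve. all: by end_near. Qed.

(** * The Lagrangian as a function of the price *)

Lemma dot_sumr (R : realType) (d n : nat) (u : 'rV[R]_d)
    (v : 'I_n -> 'rV[R]_d) :
  dot u (\sum_k v k) = \sum_k dot u (v k).
Proof.
rewrite /dot exchange_big/=; apply: eq_bigr => i _.
by rewrite summxE mulr_sumr.
Qed.

Lemma dot_consumption (R : realType) (d K : nat) (D : 'I_K -> law R d)
    (w : 'rV[R]_K) (u p : 'rV[R]_d) :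
  dot u (consumption D w p) = \sum_k w 0 k * dot u (hfun (D k) p).
Proof. by rewrite dot_sumr; apply: eq_bigr => k _; rewrite dotZr. Qed.

(** Nonnegative weights preserve the subgradient inequalities of the [gfun (D k)], and the budget
    term is linear. *)
Lemma lagrangian_subgradient (R : realType) (d K : nat) (D : 'I_K -> law R d)
    (Rmax Amax : R) (b : 'rV[R]_d) (w : 'rV[R]_K) (p q : 'rV[R]_d) :
  (forall k, bounded_law Rmax Amax (D k)) -> (forall k, 0 <= w 0 k) ->
  lagrangian D b w p + dot (q - p) (b - consumption D w p) <=
  lagrangian D b w q.
Proof.
move=> DA w0; rewrite dotBr dot_consumption dotBl /lagrangian.
have : \sum_k w 0 k * (gfun (D k) p + dot (p - q) (hfun (D k) p)) <=
       \sum_k w 0 k * gfun (D k) q.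
  by apply: ler_sum => k _; apply: ler_wpM2l => //; exact: gfun_subgradient.
under eq_bigr do rewrite mulrDr; rewrite big_split/=.
have -> : \sum_k w 0 k * dot (p - q) (hfun (D k) p) =
    - \sum_k w 0 k * dot (q - p) (hfun (D k) p).
  rewrite -sumrN; apply: eq_bigr => k _.
  by rewrite -mulrN -[in LHS]opprB -scaleN1r dotZl mulN1r.
lra.
Qed.

Lemma consumption_cvg (R : realType) (d K : nat) (D : 'I_K -> law R d)
    (Rmax Amax : R) (w : 'rV[R]_K) (q : nat -> 'rV[R]_d) (p u : 'rV[R]_d) :
  (forall k, bounded_law Rmax Amax (D k)) ->
  (forall k, continuous_valuation (D k)) ->
  (forall v, dot (q n) v @[n --> \oo] --> dot p v) ->
  dot u (consumption D w (q n)) @[n --> \oo] --> dot u (consumption D w p).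
Proof.
move=> DA Dc qp; rewrite dot_consumption.
under eq_fun do rewrite dot_consumption.
apply: cvg_big => [|k _]; first exact: add_continuous.
apply: cvgMl_tmp; apply: cvg_big => [|i _]; first exact: add_continuous.
apply: cvgMl_tmp.
exact: hfun_cvg.
Qed.

Lemma price_box_segment (R : realType) (d : nat) (M t : R) (p q : 'rV[R]_d) :
  0 <= t <= 1 -> price_box M p -> price_box M q ->
  price_box M (p + t *: (q - p)).
Proof.
move=> /andP[t0 t1] pM qM i; rewrite !mxE.
have /andP[? ?] := pM i; have /andP[? ?] := qM i.
by apply/andP; split; nra.
Qed.

(** The subgradient inequality based at [p] bounds the Lagrangian only from below, so it is based
    instead at points [y n] of the segment towards [q] that tend to [p]. *)
Lemma lagrangian_minimizer_variational (R : realType) (d K : nat)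
    (D : 'I_K -> law R d) (Rmax Amax M : R) (b : 'rV[R]_d) (w : 'rV[R]_K)
    (p q : 'rV[R]_d) :
  (forall k, bounded_law Rmax Amax (D k)) ->
  (forall k, continuous_valuation (D k)) -> (forall k, 0 <= w 0 k) ->
  price_box M p -> price_box M q ->
  (forall y, price_box M y -> lagrangian D b w p <= lagrangian D b w y) ->
  0 <= dot (q - p) (b - consumption D w p).
Proof.
move=> DA Dc w0 pM qM pmin.
(* [harmonic n] is [1 / (n + 1)], so [y 0 = q] and every [y n] lies on the segment. *)
pose y n := p + harmonic n *: (q - p).
have yp u : dot (y n) u @[n --> \oo] --> dot p u.
  under eq_fun do rewrite dotDl dotZl.
  have : dot p u + harmonic n * dot (q - p) u @[n --> \oo] -->
      dot p u + 0 * dot (q - p) u.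
    apply: cvgD; first exact: cvg_cst.
    by apply: cvgMr_tmp; exact: cvg_harmonic.
  by rewrite mul0r addr0.
have Hy : dot (q - p) (b - consumption D w (y n)) @[n --> \oo] -->
    dot (q - p) (b - consumption D w p).
  rewrite dotBr; under eq_fun do rewrite dotBr.
  by apply: cvgB; [exact: cvg_cst|exact: consumption_cvg].
apply: (cvgr_to_ge Hy); apply: nearW => n.
have h0 : 0 < harmonic n :> R by exact: harmonic_gt0.
have yM : price_box M (y n).
  apply: price_box_segment => //; rewrite ltW//= invf_le1// ler1n//.
have := lagrangian_subgradient _ _ _ _ _ _ b w (y n) p DA w0.
have := pmin _ yM.
rewrite (_ : p - y n = - harmonic n *: (q - p)); last first.
  by rewrite /y opprD addNKr scaleNr.
rewrite dotZl => ? ?.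
(* Minimality and the subgradient inequality bound the product with [harmonic n], a positive factor
   that cancels. *)
by rewrite -(pmulr_rge0 _ h0); lra.
Qed.

(** * Maximization over the simplex *)

Lemma simplex_le_max (R : realType) (K : nat) (w : 'rV[R]_K.+1)
    (F : 'I_K.+1 -> R) :
  simplex w -> \sum_k w 0 k * F k <= \big[Num.max/F ord0]_k F k.
Proof.
move=> [w0 w1]; rewrite -[leRHS]mul1r -w1 mulr_suml; apply: ler_sum => k _.
by rewrite ler_wpM2l//; exact: le_bigmax.
Qed.

(** Indices of weight zero contribute nothing, and at all others [F] equals the maximum. *)
Lemma simplex_eq_max (R : realType) (K : nat) (w : 'rV[R]_K.+1)
    (F : 'I_K.+1 -> R) :
  simplex w -> supp_w w `<=` argmax F setT ->
  \sum_k w 0 k * F k = \big[Num.max/F ord0]_k F k.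
Proof.
move=> [w0 w1] wF; rewrite -[RHS]mul1r -w1 mulr_suml; apply: eq_bigr => k _.
have [->|wk] := eqVneq (w 0 k) 0; first by rewrite !mul0r.
have [|_ Fk] := wF k; first by rewrite /supp_w/= lt_neqAle eq_sym wk w0.
congr (_ * _); apply/eqP; rewrite eq_le le_bigmax/=.
by apply/bigmax_leP; split => [|j _]; exact: Fk.
Qed.

(** Testing against the vertices [delta_mx 0 j] bounds every [F j] by the optimal value [S]. The
    weighted gaps [S - F j] are then nonnegative with sum zero, so a positive weight forces its gap
    to vanish. *)
Lemma simplex_argmax_supp (R : realType) (K : nat) (w : 'rV[R]_K)
    (F : 'I_K -> R) :
  simplex w ->
  (forall v, simplex v -> \sum_k v 0 k * F k <= \sum_k w 0 k * F k) ->
  supp_w w `<=` argmax F setT.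
Proof.
move=> [w0 w1] wmax; set S := \sum_k w 0 k * F k in wmax *.
have FS j : F j <= S.
  have : simplex (delta_mx 0 j : 'rV[R]_K).
    split=> [k|]; first by rewrite mxE; case: (_ && _).
    rewrite (bigD1 j)//= mxE !eqxx big1 ?addr0// => k /negPf kj.
    by rewrite mxE kj andbF.
  move=> /wmax; rewrite (bigD1 j)//= mxE !eqxx mul1r big1 ?addr0// => k /negPf kj.
  by rewrite mxE kj andbF mul0r.
move=> k; rewrite /supp_w/= => wk.
have : \sum_j w 0 j * (S - F j) = 0.
  under eq_bigr do rewrite mulrBr.
  by rewrite sumrB -mulr_suml w1 mul1r subrr.
move/eqP; rewrite psumr_eq0; last by move=> j _; rewrite mulr_ge0// subr_ge0.
move=> /allP/(_ k (mem_index_enum _)); rewrite mulf_eq0 gt_eqF//= subr_eq0.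
by move=> /eqP SF; split => // j _; rewrite -SF.
Qed.

(** * Deviations in one coordinate and the upper price bound *)

Lemma dot_set_coord (R : realType) (d : nat) (p v : 'rV[R]_d) (i : 'I_d)
    (t : R) :
  dot ((\row_j if j == i then t else p 0 j) - p) v = (t - p 0 i) * v 0 i.
Proof.
rewrite /dot (bigD1 i)//= !mxE eqxx big1 ?addr0// => j /negPf ji.
by rewrite !mxE ji subrr mul0r.
Qed.

Lemma bmin_le (R : realType) (d : nat) (b : 'rV[R]_d.+1) i : bmin b <= b 0 i.
Proof. exact: bigmin_le. Qed.

(* An expensive coordinate costs more than the value [Rmax] attainable at price
   zero. *)
Lemma minimizer_lt_Pmax (R : realType) (d K : nat) (D : 'I_K -> law R d.+1)
    (Rmax Amax : R) (b : 'rV[R]_d.+1) (w : 'rV[R]_K) (p : 'rV[R]_d.+1)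
    (i : 'I_d.+1) :
  0 < Rmax -> (forall k, bounded_law Rmax Amax (D k)) -> 0 < bmin b ->
  simplex w -> price_box (Pmax Rmax b) p ->
  (forall y, price_box (Pmax Rmax b) y ->
    lagrangian D b w p <= lagrangian D b w y) ->
  p 0 i < Pmax Rmax b.
Proof.
move=> R0 DA bm0 [w0 w1] pP pmin.
have P0 : 0 <= Pmax Rmax b by rewrite divr_ge0// ltW// mulr_gt0.
have b0 j : 0 <= b 0 j by rewrite (le_trans (ltW bm0))// bmin_le.
have p0 j : 0 <= p 0 j by have /andP[] := pP j.
have L0 : lagrangian D b w 0 <= Rmax.
  rewrite /lagrangian dot0l add0r -[leRHS]mul1r -w1 mulr_suml.
  apply: ler_sum => k _; rewrite ler_wpM2l//.
  by apply: gfun0_le (DA k); exact: ltW.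
have Lp : p 0 i * b 0 i <= lagrangian D b w p.
  rewrite /lagrangian /dot (bigD1 i)//= -addrA lerDl addr_ge0// sumr_ge0// => j _.
    by rewrite mulr_ge0.
  by rewrite mulr_ge0// gfun_ge0.
have pb : p 0 i * bmin b <= p 0 i * b 0 i by rewrite ler_wpM2l// bmin_le.
(* The factor 2 in [Pmax] makes the bound strict: [p 0 i * bmin b <= Rmax < 2 * Rmax]. *)
have := pmin 0; rewrite ltr_pdivlMr//.
have box0 : price_box (Pmax Rmax b) (0 : 'rV_d.+1) by move=> j; rewrite mxE lexx.
by move=> /(_ box0) ?; lra.
Qed.

Theorem theorem7 (R : realType) (d K : nat)
    (D : 'I_K.+1 -> law R d.+1) (Rmax Amax : R) (b : 'rV[R]_d.+1)
    (Rmax_gt0 : 0 < Rmax) (Amax_gt0 : 0 < Amax)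
    (D_orthant : forall k, law_on_orthant (D k))
    (D_bounded : forall k, bounded_law Rmax Amax (D k))
    (D_cont : forall k, continuous_valuation (D k))
    (b_ge0 : le_vec 0 b) (bmin_gt0 : 0 < bmin b) :
  let P : set 'rV[R]_d.+1 := price_box (Pmax Rmax b) in
  saddle_points (lagrangian D b) (@simplex R K.+1) P = kkt_set D b P.
Proof.
move=> P; apply/seteqP; split => -[w p] [/=].
  move=> ws pP wmax pmin; have [w0 w1] := ws.
  have supp_best : supp_w w `<=` best_configs D p.
    apply: simplex_argmax_supp => // v vs.
    by have := wmax v vs; rewrite lerD2l.
  set s := b - consumption D w p.
  have var q : P q -> 0 <= dot (q - p) s.
    by move=> qP; exact: (lagrangian_minimizer_variational _ _ _ _ _ _ _ _ _ _ _
      D_bounded D_cont w0 pP qP pmin).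
  have coord i t : 0 <= t <= Pmax Rmax b -> 0 <= (t - p 0 i) * s 0 i.
    move=> tP; rewrite -dot_set_coord; apply: var => j; rewrite mxE.
    by case: eqP => // _; exact: pP.
  have pmax i : p 0 i < Pmax Rmax b.
    exact: (minimizer_lt_Pmax _ _ _ _ _ _ _ _ _ _ Rmax_gt0 D_bounded).
  have p0 i : 0 <= p 0 i by have /andP[] := pP i.
  have s0 i : 0 <= s 0 i.
    (* Raising coordinate [i] to [Pmax Rmax b] is a strict increase, which forces [s 0 i] to be
       nonnegative. *)
    rewrite -(@pmulr_rge0 _ (Pmax Rmax b - p 0 i)) ?subr_gt0//.
    by apply: coord; rewrite lexx (le_trans (p0 i))// ltW.
  split => //=.
  (* The chain is [f(p) = L(w, p) <= L(w, y) <= f(y)], with equality at [p] by the support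
     condition. *)
  - split => // y yP; apply: (@le_trans _ _ (lagrangian D b w y)); last first.
      by rewrite lerD2l simplex_le_max.
    apply: le_trans (pmin y yP).
    by rewrite lerD2l simplex_eq_max.
  - by move=> i; have := s0 i; rewrite !mxE subr_ge0.
  - rewrite /dot big1// => i _; apply/eqP; rewrite eq_le mulr_ge0// andbT.
    (* Lowering coordinate [i] to [0] gives [p 0 i * s 0 i <= 0]. *)
    have := coord i 0; rewrite lexx ltW ?(le_lt_trans (p0 i))// => /(_ isT).
    by rewrite sub0r mulNr oppr_ge0.
move=> [ws pP] _ supp_best Hb comp; have [w0 _] := ws.
(* [dual_obj D b p] bounds [lagrangian D b v p] for every [v] in the simplex, and [w] attains it. *)
have LE : lagrangian D b w p = dual_obj D b p.
  by congr (_ + _); exact: simplex_eq_max.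
split => //= [v vs|y yP]; first by rewrite LE lerD2l simplex_le_max.
(* Complementary slackness reduces the linear term to [<y, b - H (w, p)>], a product of nonnegative
   vectors. *)
apply: le_trans (lagrangian_subgradient _ _ _ _ _ _ b w p y D_bounded w0).
rewrite lerDl dotBl comp subr0 sumr_ge0// => i _.
have /andP[y0 _] := yP i.
by rewrite mulr_ge0//; have := Hb i; rewrite !mxE subr_ge0.
Qed.
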